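(* Let $\Gamma=(V,E)$ be a connected simple graph of order $n$, minimum degree $\delta$ and maximum degree $\Delta$, let $\mu_*$ be the Laplacian spectral radius of $\Gamma$, and let $k\in\{-\Delta,\dots,\Delta\}$. Then $$\zeta_k(\Gamma)\ \le\ \frac{n}{\mu_*}\left(\mu_*-\left\lceil\frac{\delta+k}{2}\right\rceil\right).$$
   Context: For $S\subseteq V$ and $v\in V$, $\delta_S(v)$ denotes the number of neighbors of $v$ in $S$, and $\overline{S}=V\setminus S$. For an integer $k$, a nonempty set $S\subseteq V$ is a defensive $k$-alliance if $\delta_S(v)\ge\delta_{\overline{S}}(v)+k$ for every $v\in S$. A set $Y\subseteq V$ is a defensive $k$-alliance cover ($k$-dac) if $S\cap Y\ne\emptyset$ for every defensive $k$-alliance $S$ of $\Gamma$. $\zeta_k(\Gamma)$ denotes the smallest cardinality of a $k$-dac set in $\Gamma$. The Laplacian spectral radius of $\Gamma$ is the largest eigenvalue of the Laplacian matrix of $\Gamma$. *)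

(* Defs.v *)
From mathcomp Require Import all_boot all_order all_algebra.
From mathcomp Require Import boolp reals.

Set Implicit Arguments.
Unset Strict Implicit.
Unset Printing Implicit Defensive.

Import Order.TTheory GRing.Theory Num.Theory.
Local Open Scope ring_scope.

(* A simple graph is a symmetric irreflexive [e : rel T] on a finite vertex
   type [T], so that its order is [#|T|]. *)

Definition connected_graph (T : finType) (e : rel T) : Prop :=
  forall x y : T, connect e x y.

Definition nbrs_in (T : finType) (e : rel T) (S : {set T}) (v : T) : nat :=
  #|[set u in S | e v u]|.

Definition degree (T : finType) (e : rel T) (v : T) : nat :=
  #|[set u | e v u]|.

(* The default [#|T|] is never below the degree of a vertex, so it does not
   affect the minimum over a nonempty graph. *)
Definition min_degree (T : finType) (e : rel T) : nat :=
  \big[minn/#|T|]_(v : T) degree e v.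

Definition max_degree (T : finType) (e : rel T) : nat :=
  (\max_(v : T) degree e v)%N.

Definition defensive_alliance (T : finType) (e : rel T) (k : int)
    (S : {set T}) : bool :=
  (S != set0) &&
  [forall v in S, (nbrs_in e (~: S) v)%:Z + k <= (nbrs_in e S v)%:Z].

Definition dac (T : finType) (e : rel T) (k : int) (Y : {set T}) : bool :=
  [forall S : {set T}, defensive_alliance e k S ==> (S :&: Y != set0)].

(* The default [#|T|] is the cardinality of [setT], which is always a k-dac. *)
Definition zeta (T : finType) (e : rel T) (k : int) : nat :=
  \big[minn/#|T|]_(Y : {set T} | dac e k Y) #|Y|.

(* Rows and columns are indexed by the enumeration of the vertices. *)
Definition laplacian (R : realType) (T : finType) (e : rel T) : 'M[R]_#|T| :=
  \matrix_(i, j) if i == j then (degree e (enum_val i))%:R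
                 else - (e (enum_val i) (enum_val j))%:R.

Definition laplacian_spectral_radius (R : realType) (T : finType) (e : rel T)
    (mu : R) : Prop :=
  eigenvalue (laplacian R e) mu /\
  forall nu : R, eigenvalue (laplacian R e) nu -> nu <= mu.

Lemma dac_setT (T : finType) (e : rel T) (k : int) : dac e k setT.
Proof. by apply/forallP => S; apply/implyP => /andP[S0 _]; rewrite setIT. Qed.

Lemma max_root (R : realFieldType) (p : {poly R}) : p != 0 ->
  (forall x, ~~ root p x) \/
  (exists m, root p m /\ forall x, root p x -> x <= m).
Proof.
have [n] := ubnP (size p); elim: n p => // n IH p szp p0.
have [[a pa]|noroot] := pselect (exists a, root p a); last first.
  by left=> x; apply/negP => px; apply: noroot; exists x.
right; have [q def_p] := factor_theorem p a pa.
have q0 : q != 0 by apply: contraNneq p0 => q0; rewrite def_p q0 mul0r.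
have szq : (size q < n)%N.
  by move: szp; rewrite def_p size_Mmonic ?monicXsubC // size_XsubC addn2.
have rootE x : root p x = root q x || (x == a).
  by rewrite def_p rootM root_XsubC.
have [noq|[m [qm maxm]]] := IH q szq q0.
  exists a; split=> // x; rewrite rootE (negPf (noq x)) /=.
  by move=> /eqP ->.
exists (Order.max m a); split.
  by rewrite rootE; case: (leP m a); rewrite ?eqxx ?orbT ?qm.
by move=> x; rewrite rootE le_max => /orP[/maxm ->|/eqP ->]; rewrite ?lexx ?orbT.
Qed.

Lemma laplacian_spectral_radius_exists (R : realType) (T : finType)
    (e : rel T) (e_sym : symmetric e) (e_irr : irreflexive e) (hT : (0 < #|T|)%N) :
  exists mu : R, laplacian_spectral_radius e mu.
Proof.
set L := laplacian R e.
have ev0 : eigenvalue L 0.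
  apply/eigenvalueP; exists (const_mx 1); last first.
    apply/eqP => /rowP /(_ (Ordinal hT)).
    by rewrite !mxE => /eqP; rewrite oner_eq0.
  rewrite scale0r; apply/rowP => j; rewrite !mxE (bigD1 j) //= !mxE eqxx mul1r.
  rewrite (eq_bigr (fun i => - (e (enum_val i) (enum_val j))%:R)); last first.
    by move=> i /negPf ne_ij; rewrite !mxE ne_ij mul1r.
  rewrite sumrN; apply/eqP; rewrite subr_eq0; apply/eqP.
  rewrite -natr_sum; congr _%:R.
  have -> : degree e (enum_val j) =
      (\sum_(i < #|T|) e (enum_val i) (enum_val j))%N.
    rewrite -(big_enum_val (A := T) (fun x => e x (enum_val j) : nat)) /=.
    rewrite /degree -sum1dep_card big_mkcond /=.
    by apply: eq_bigr => u _; rewrite e_sym; case: (e _ _).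
  by rewrite (bigD1 j) //= e_irr.
have cp0 : char_poly L != 0 by rewrite monic_neq0 // char_poly_monic.
have [noroot|[m [Lm maxm]]] := max_root cp0.
  by move: ev0; rewrite eigenvalue_root_char (negPf (noroot 0)).
exists m; split; first by rewrite eigenvalue_root_char.
by move=> nu; rewrite eigenvalue_root_char; apply: maxm.
Qed.

(* Main.v *)
Require Import Defs.
From mathcomp Require Import all_boot all_order all_algebra spectral.
From mathcomp Require Import reals complex.
From mathcomp Require Import ring lra zify.

Set Implicit Arguments.
Unset Strict Implicit.
Unset Printing Implicit Defensive.

Import Order.TTheory GRing.Theory Num.Theory.
Local Open Scope ring_scope.

(** Take a dac [Y] that is minimal for inclusion.  Removing a vertex [v] from
    [Y] uncovers some alliance [S]; it meets [Y] only in [v], so all neighbors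
    of [v] in [S] lie outside [Y].  The alliance condition at [v] then says
    that at least [(degree v + k) / 2] neighbors of [v], hence at least
    [c = ceil ((delta + k) / 2)] of them, lie outside [Y]
    ([minimal_dac_nbrs]).  Summing over [Y], at least [c |Y|] edges run between
    [Y] and its complement.

    On the other hand, the Laplacian quadratic form of a function [f] on the
    vertices is the sum of [(f v - f u)^2] over the edges ([laplacian_form]),
    and it is at most [mu] times the squared norm of [f], because the Laplacian
    is symmetric with largest eigenvalue [mu] ([rayleigh_le]).  Applied to a
    function taking one value on [X], another on its complement, and summing to
    zero, this bounds the number of edges leaving [X] by
    [mu |X| (n - |X|) / n] ([cut_le_spectral_radius]).

    For [X] the complement of [Y], comparing both counts and dividing by [|Y|]
    gives [n c <= mu (n - |Y|)], which is the claim.  The division requires [Y]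
    nonempty; when the empty set is itself a dac, a single vertex of maximum
    degree is used as [Y] instead, and this is where [k <= Delta] enters
    ([exists_dac_nbrs]). *)

(** * The Rayleigh bound for real symmetric matrices *)

(** From [A = P^-1 D P], with [P = spectralmx A], follows [P A = D P]: the rows
    of [P] are eigenvectors. *)
Lemma spectral_diag_eigenvalue (C : numClosedFieldType) (n : nat) (A : 'M[C]_n)
    (j : 'I_n) : A \is normalmx -> eigenvalue A (spectral_diag A 0 j).
Proof.
move=> /orthomx_spectralP A_eq; set P := spectralmx A.
have PA : P *m A = diag_mx (spectral_diag A) *m P.
  by rewrite [in LHS]A_eq !mulmxA mulmxV ?mul1mx // spectral_unit.
apply/eigenvalueP; exists (row j P).
  by rewrite -row_mul PA; apply/rowP => i; rewrite mxE mul_diag_mx !mxE.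
rewrite rowE mulmx_free_eq0 ?row_free_unit ?spectral_unit //.
by apply/eqP => /rowP/(_ j)/eqP; rewrite !mxE !eqxx oner_eq0.
Qed.

Local Open Scope complex_scope.
Local Open Scope sesquilinear_scope.

(** The matrix is diagonalized by a unitary matrix over the complex numbers.
    Its spectrum there is real because it is Hermitian, and a real eigenvalue
    of a real matrix over the complex numbers is already one over the reals,
    so the bound [mu] applies to every diagonal entry. *)
Lemma rayleigh_le (R : rcfType) (n : nat) (A : 'M[R]_n) (mu : R) :
  A^T = A -> (forall nu, eigenvalue A nu -> nu <= mu) ->
  forall x : 'rV[R]_n, (x *m A *m x^T) 0 0 <= mu * (x *m x^T) 0 0.
Proof.
move=> A_sym le_mu x.
pose toC := real_complex R : {rmorphism R -> R[i]}.
have real_toC m p (M : 'M[R]_(m, p)) : map_mx toC M \is a mxOver Num.real.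
  by apply/mxOverP => i j; rewrite mxE; apply/complex_realP; exists (M i j).
set B := map_mx toC A; set z := map_mx toC x.
have B_adj : B^t* = B by rewrite /B map_trmx A_sym realmxC.
have z_adj : z^t* = map_mx toC x^T by rewrite /z map_trmx realmxC.
have B_norm : B \is normalmx by apply/normalmxP; rewrite B_adj.
have B_eig j : exists2 nu, spectral_diag B 0 j = toC nu & nu <= mu.
  have /mxOverP/(_ 0 j)/complex_realP[nu eq_nu] :
      spectral_diag B \is a mxOver Num.real.
    apply: hermitian_spectral_diag_real.
    apply: realsym_hermsym (real_toC _ _ A).
    apply/is_hermitianmxP.
    by rewrite expr0 scale1r map_mx_id // /B map_trmx A_sym.
  exists nu => //; apply: le_mu; rewrite -(eigenvalue_map toC).
  by have := spectral_diag_eigenvalue j B_norm; rewrite eq_nu.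
have P_unit := spectral_unitarymx B; set P := spectralmx B in P_unit.
set y := z *m P^t*.
have y_adj : y^t* = P *m z^t*.
  by rewrite trmx_mul map_mxM trmxCK.
have sqr_norm_y j : `|y 0 j| ^+ 2 = y 0 j * (y^t*) j 0.
  by rewrite normCK; congr (_ * _); rewrite [RHS]mxE [in RHS]mxE.
have form_toC (M : 'M[R]_n) : toC ((x *m M *m x^T) 0 0)
    = (z *m map_mx toC M *m z^t*) 0 0.
  by rewrite z_adj -!map_mxM [RHS]mxE.
have B_form : toC ((x *m A *m x^T) 0 0)
    = \sum_j spectral_diag B 0 j * `|y 0 j| ^+ 2.
  rewrite form_toC -/B [in LHS](orthomx_spectralP B_norm) invmx_unitary //.
  rewrite !mulmxA -/y -(mulmxA _ P) -y_adj mxE; apply: eq_bigr => j _.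
  by rewrite mul_mx_diag [in LHS]mxE mulrAC mulrC sqr_norm_y.
have one_form : toC ((x *m x^T) 0 0) = \sum_j `|y 0 j| ^+ 2.
  rewrite -[x in x *m _]mulmx1 form_toC map_mx1 mulmx1.
  have -> : z *m z^t* = y *m y^t*.
    by rewrite y_adj /y mulmxA mulmxKtV // trmxC_unitary.
  by rewrite mxE; apply: eq_bigr => j _; rewrite sqr_norm_y.
rewrite -lecR -/toC rmorphM /= -/(toC mu) B_form one_form mulr_sumr.
apply: ler_sum => j _; have [nu -> le_nu] := B_eig j.
by apply: ler_wpM2r; rewrite ?exprn_ge0 // lecR.
Qed.

Local Close Scope complex_scope.
Local Close Scope sesquilinear_scope.

(** * Degrees, and the Laplacian quadratic form *)

Lemma degreeE (T : finType) (e : rel T) (v : T) :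
  degree e v = (\sum_u e v u)%N.
Proof.
rewrite /degree -sum1dep_card big_mkcond /=.
by apply: eq_bigr => u _; case: (e v u).
Qed.

Lemma nbrs_inE (T : finType) (e : rel T) (S : {set T}) (v : T) :
  nbrs_in e S v = (\sum_(u in S) e v u)%N.
Proof.
rewrite /nbrs_in -sum1dep_card big_mkcond [RHS]big_mkcond /=.
by apply: eq_bigr => u _; case: (u \in S) (e v u) => [] [].
Qed.

Lemma degree_split (T : finType) (e : rel T) (S : {set T}) (v : T) :
  degree e v = (nbrs_in e S v + nbrs_in e (~: S) v)%N.
Proof.
rewrite degreeE !nbrs_inE (bigID (mem S)) /=; congr addn.
by apply: eq_bigl => u; rewrite inE.
Qed.

Lemma nbrs_in_setC1 (T : finType) (e : rel T) (v : T) :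
  irreflexive e -> nbrs_in e (~: [set v]) v = degree e v.
Proof.
move=> e_irr; apply: eq_card => u; rewrite !inE; have [->|//] := eqVneq u v.
by rewrite e_irr.
Qed.

Lemma laplacian_sym (R : realType) (T : finType) (e : rel T) :
  symmetric e -> (laplacian R e)^T = laplacian R e.
Proof.
move=> e_sym; apply/matrixP => i j; rewrite !mxE eq_sym e_sym.
by case: eqP => [->|].
Qed.

(** The factor 2 is there because the double sum runs over ordered pairs and
    so meets every edge twice. *)
Lemma laplacian_form (R : realType) (T : finType) (e : rel T) (f : T -> R) :
  symmetric e -> irreflexive e ->
  let x := \row_(i < #|T|) f (enum_val i) in
  2 * (x *m laplacian R e *m x^T) 0 0
    = \sum_v \sum_u (e v u)%:R * (f v - f u) ^+ 2.
Proof.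
move=> e_sym e_irr x.
pose q := \sum_v \sum_u (e v u)%:R * (f v * (f v - f u)).
have xL j (v := enum_val j) :
    (x *m laplacian R e) 0 j = \sum_u (e v u)%:R * (f v - f u).
  rewrite mxE; under eq_bigr => i _.
    rewrite !mxE -(inj_eq enum_val_inj) -/v.
    over.
  rewrite -(big_enum_val (A := T) (fun u => f u *
    if u == v then (degree e u)%:R else - (e u v)%:R)) /=.
  rewrite (bigD1 v) //= eqxx degreeE natr_sum mulr_sumr.
  rewrite [RHS](eq_bigr (fun u => f v * (e v u)%:R - f u * (e u v)%:R));
    last by move=> u _; rewrite (e_sym u v); ring.
  rewrite sumrB; congr (_ + _); rewrite [in RHS](bigD1 v) //= e_irr mulr0 add0r.
  by rewrite -sumrN; apply: eq_bigr => u /negPf->; rewrite mulrN.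
have -> : (x *m laplacian R e *m x^T) 0 0 = q.
  rewrite mxE /q (big_enum_val (A := T)) /=; apply: eq_bigr => j _.
  rewrite xL !mxE mulr_suml; apply: eq_bigr => u _; ring.
(* Adding the double sum to its copy with v and u exchanged makes a square. *)
rewrite mulr2n mulrDl mul1r {2}/q exchange_big -big_split.
apply: eq_bigr => v _.
by rewrite -big_split; apply: eq_bigr => u _ /=; rewrite e_sym; ring.
Qed.

(** * Edge cuts and the spectral radius *)

(** The square is 1 on ordered pairs separated by [X] and 0 elsewhere, so every
    edge of the cut is met once in each direction. *)
Lemma sum_cut_sqr (R : realType) (T : finType) (e : rel T) (X : {set T}) :
  symmetric e ->
  \sum_v \sum_u (e v u)%:R * ((v \in X)%:R - (u \in X)%:R) ^+ 2
    = 2 * (\sum_(v in ~: X) nbrs_in e X v)%:R :> R.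
Proof.
move=> e_sym.
pose half := \sum_v \sum_u (e v u)%:R * ((v \notin X)%:R * (u \in X)%:R) : R.
have -> : (\sum_(v in ~: X) nbrs_in e X v)%:R = half.
  rewrite natr_sum big_mkcond; apply: eq_bigr => v _; rewrite inE.
  case: (v \in X) => /=; first by rewrite big1 // => u _; rewrite mul0r mulr0.
  rewrite nbrs_inE natr_sum big_mkcond; apply: eq_bigr => u _.
  by case: (u \in X); rewrite mul1r ?mulr1 ?mulr0.
rewrite mulr2n mulrDl mul1r [X in _ = _ + X]exchange_big -big_split.
apply: eq_bigr => v _.
rewrite -big_split; apply: eq_bigr => u _ /=; rewrite (e_sym u v).
by case: (v \in X) (u \in X) => [] [] /=; ring.
Qed.

(** The test function is [|~: X|] on [X] and [- |X|] elsewhere: it is the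
    indicator of [X], scaled by the order of the graph and shifted to be
    orthogonal to the constants.  The shift leaves its differences, hence the
    Laplacian form, unchanged, and minimizes the norm; the indicator alone
    would lack the factor [|~: X|] over the order of the graph. *)
Lemma cut_le_spectral_radius (R : realType) (T : finType) (e : rel T) (mu : R)
    (X : {set T}) : symmetric e -> irreflexive e ->
  laplacian_spectral_radius e mu ->
  #|T|%:R * (\sum_(v in ~: X) nbrs_in e X v)%:R <= mu * (#|X| * #|~: X|)%:R.
Proof.
move=> e_sym e_irr [_ le_mu].
have cardT : #|T|%:R = #|X|%:R + #|~: X|%:R :> R by rewrite -natrD cardsC.
have [T0|T_gt0] := posnP #|T|.
  have -> : #|X| = 0%N by apply/eqP; rewrite -leqn0 -T0 max_card.
  by rewrite T0 mul0r mulr0.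
pose f v : R := if v \in X then #|~: X|%:R else - #|X|%:R.
have f_diff v u : f v - f u = #|T|%:R * ((v \in X)%:R - (u \in X)%:R).
  by rewrite /f cardT; case: (v \in X) (u \in X) => [] [] /=; ring.
have := laplacian_form f e_sym e_irr.
set x := \row_i _ => /= form_x.
have norm_x : (x *m x^T) 0 0 = #|T|%:R * (#|X| * #|~: X|)%:R.
  rewrite mxE; under eq_bigr do rewrite !mxE -expr2.
  rewrite -(big_enum_val (A := T) (fun v => f v ^+ 2)) /= (bigID (mem X)) /=.
  rewrite (eq_bigr (fun=> #|~: X|%:R ^+ 2)) => [|v vX]; last by rewrite /f vX.
  rewrite [X in _ + X](eq_big (mem (~: X)) (fun=> #|X|%:R ^+ 2)); first 1 last.
  - by move=> v; rewrite !inE.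
  - by move=> v /negPf vX; rewrite /f vX sqrrN.
  rewrite !sumr_const -[X in X + _]mulr_natr -[X in _ + X]mulr_natr natrM cardT.
  ring.
have {form_x} form_x : (x *m laplacian R e *m x^T) 0 0
    = #|T|%:R ^+ 2 * (\sum_(v in ~: X) nbrs_in e X v)%:R.
  apply: (mulfI (_ : 2 != 0 :> R)); first by rewrite pnatr_eq0.
  rewrite form_x mulrCA -sum_cut_sqr // mulr_sumr; apply: eq_bigr => v _.
  by rewrite mulr_sumr; apply: eq_bigr => u _; rewrite f_diff; ring.
have := rayleigh_le (laplacian_sym R e_sym) le_mu x.
by rewrite form_x norm_x mulrCA expr2 -mulrA ler_pM2l // ltr0n.
Qed.

(** By connectedness some vertex has a neighbor; the cut around it is then
    nonempty, and a positive cut forces a positive bound on it. *)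
Lemma spectral_radius_gt0 (R : realType) (T : finType) (e : rel T) (mu : R) :
  symmetric e -> irreflexive e -> connected_graph e -> (1 < #|T|)%N ->
  laplacian_spectral_radius e mu -> 0 < mu.
Proof.
move=> e_sym e_irr e_conn T_gt1 mu_max.
have /card_gt1P[v [w [_ _ v_neq_w]]] : (1 < #|T|)%N by [].
have [u evu] : exists u, e v u.
  have /connectP[[|u p] /= path_p eq_w] := e_conn v w.
    by rewrite eq_w eqxx in v_neq_w.
  by exists u; case/andP: path_p.
have := cut_le_spectral_radius (~: [set v]) e_sym e_irr mu_max.
rewrite setCK big_set1 nbrs_in_setC1 // cards1 muln1 => le_mu.
have : 0 < mu * #|~: [set v]|%:R.
  apply: lt_le_trans le_mu; rewrite mulr_gt0 ?ltr0n ?(ltnW T_gt1) //.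
  by apply/card_gt0P; exists u; rewrite inE.
by rewrite pmulr_lgt0 // ltr0n cardsC1 -ltnS prednK // ltnW.
Qed.

(** * Minimal alliance covers *)

(** By minimality some alliance [S] avoids [Y :\ v]; it meets [Y] only in [v],
    so the neighbors of [v] in [S] are outside [Y] and the alliance condition
    at [v] bounds their number below. *)
Lemma minimal_dac_nbrs (T : finType) (e : rel T) (k : int) (Y : {set T})
    (v : T) :
  irreflexive e -> minset (dac e k) Y -> v \in Y ->
  (degree e v)%:Z + k <= (nbrs_in e (~: Y) v)%:Z * 2.
Proof.
move=> e_irr /minsetP[dacY minY] vY.
have : ~~ dac e k (Y :\ v).
  apply/negP => /minY/(_ (subD1set _ _)) YE.
  by move: vY; rewrite -YE !inE eqxx.
rewrite negb_forall => /existsP[S].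
rewrite negb_imply negbK => /andP[S_al /eqP SY0].
have /set0Pn[w /setIP[wS wY]] : S :&: Y != set0.
  by move/forallP/(_ S)/implyP: dacY; apply.
have only_v u : u \in S -> u \in Y -> u = v.
  move=> uS uY; apply/eqP; apply: contraT => uv.
  by have := in_set0 u; rewrite -SY0 !inE uS uY uv.
have vS : v \in S by rewrite -(only_v w).
have le_nbrs : (nbrs_in e S v <= nbrs_in e (~: Y) v)%N.
  apply/subset_leq_card/subsetP => u; rewrite !inE => /andP[uS evu].
  rewrite evu andbT; apply/negP => uY.
  by move: evu; rewrite (only_v u) // e_irr.
have /andP[_ /forall_inP/(_ v vS) al_v] := S_al.
rewrite (degree_split e S) PoszD.
by move: al_v le_nbrs; rewrite -lez_nat; lia.
Qed.

Lemma min_degree_le (T : finType) (e : rel T) (v : T) :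
  (min_degree e <= degree e v)%N.
Proof.
by rewrite /min_degree -minEnat -leEnat; apply: bigmin_inf (lexx _).
Qed.

Lemma zeta_le (T : finType) (e : rel T) (k : int) (Y : {set T}) :
  dac e k Y -> (zeta e k <= #|Y|)%N.
Proof.
by move=> dacY; rewrite /zeta -minEnat -leEnat; apply: bigmin_inf dacY (lexx _).
Qed.

(** If the empty set is a dac, there is no alliance at all and every set is a
    dac.  A vertex of maximum degree then does: all its neighbors are outside
    the singleton, and [min_degree + k <= 2 * max_degree]. *)
Lemma exists_dac_nbrs (T : finType) (e : rel T) (k : int) :
  irreflexive e -> (0 < #|T|)%N -> k <= (max_degree e)%:Z ->
  exists Y : {set T}, [/\ dac e k Y, Y != set0 &
    forall v, v \in Y -> (min_degree e)%:Z + k <= (nbrs_in e (~: Y) v)%:Z * 2].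
Proof.
move=> e_irr T_gt0 le_k.
have [Y minY] : {Y : {set T} | minset (dac e k) Y}.
  by apply: ex_minset; exists setT; apply: dac_setT.
have [dacY _] := minsetP minY.
have [Y0|Y_neq0] := eqVneq Y set0; last first.
  exists Y; split=> // v vY; apply: le_trans (minimal_dac_nbrs e_irr minY vY).
  by rewrite lerD2r lez_nat min_degree_le.
have [v max_v] := bigop.eq_bigmax (degree e) T_gt0.
exists [set v]; split; last 1 first.
- move=> _ /set1P->.
  rewrite nbrs_in_setC1 //.
  move: le_k; rewrite /max_degree max_v; have := min_degree_le e v.
  by rewrite -lez_nat; lia.
- apply/forallP => S; apply/implyP => S_al.
  move: dacY => /forallP/(_ S)/implyP/(_ S_al).
  by rewrite Y0 setI0 eqxx.
- by apply/set0Pn; exists v; rewrite set11.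
Qed.

(** * The bound on the alliance cover number *)

Theorem theorem20 (R : realType) (T : finType) (e : rel T)
    (e_sym : symmetric e) (e_irr : irreflexive e)
    (e_conn : connected_graph e) (hn : (1 < #|T|)%N)
    (mu : R) (hmu : laplacian_spectral_radius e mu)
    (k : int) (hk : - (max_degree e)%:Z <= k <= (max_degree e)%:Z) :
  (zeta e k)%:R <=
  #|T|%:R / mu *
    (mu - (Num.ceil (((min_degree e)%:R + k%:~R) / 2 : R))%:~R).
Proof.
have mu_gt0 := spectral_radius_gt0 e_sym e_irr e_conn hn hmu.
have [_ le_k] := andP hk.
have [Y [dacY Y_neq0 nbrsY]] := exists_dac_nbrs e_irr (ltnW hn) le_k.
set c := Num.ceil _.
have c_le v : v \in Y -> c%:~R <= (nbrs_in e (~: Y) v)%:R :> R.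
  move=> vY; rewrite -[_%:R]/((nbrs_in e (~: Y) v)%:Z%:~R) ler_int ceil_le_int.
  rewrite ler_pdivrMr //; have := nbrsY v vY.
  by rewrite -(ler_int R) intrD intrM.
have Y_gt0 : 0 < #|Y|%:R :> R by rewrite ltr0n card_gt0.
have := cut_le_spectral_radius (~: Y) e_sym e_irr hmu.
rewrite setCK natrM natr_sum mulrA => cut_le.
have c_card : #|T|%:R * c%:~R <= mu * #|~: Y|%:R.
  rewrite -(ler_pM2r Y_gt0); apply: le_trans cut_le.
  rewrite -mulrA ler_wpM2l // mulr_natr -sumr_const.
  exact: ler_sum.
apply: (@le_trans _ _ #|Y|%:R); first by rewrite ler_nat zeta_le.
have -> : #|T|%:R / mu * (mu - c%:~R) = (mu * #|T|%:R - #|T|%:R * c%:~R) / mu.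
  by field; rewrite gt_eqF.
rewrite ler_pdivlMr // -(cardsC Y) natrD.
by move: c_card; rewrite -(cardsC Y) natrD; lra.
Qed.
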